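(* Let $k\in\{1,2\}$, let $\mathsf{v}$ be a $k$-Dini gauge on $k$-simplices in $D$, and let $(\omega^j)_{j\ge1}$ be a sequence of sewable $k$-germs in $D$ such that $$\omega^j\to\omega\ \text{ pointwise for some $k$-germ }\omega\text{ in }D\qquad\text{and}\qquad \sup_{j\ge1}[\omega^j-\operatorname{sew}\omega^j]_{\mathsf{v}}<\infty.$$ Then $\omega$ is $\mathsf{v}$-sewable and $\operatorname{sew}\omega^j\to\operatorname{sew}\omega$ pointwise.
   Context: Let $D\subseteq\mathbb{R}^d$ be a set. A $k$-simplex in $D$ is a tuple $S=[p_0p_1\ldots p_k]\in D^{k+1}$ with $\operatorname{conv}(S)\subseteq D$; $\operatorname{Simp}^k(D)$ is the set of $k$-simplices, and $\operatorname{Chain}^k(D)$ the real vector space generated by them. A $k$-germ in $D$ is a function $\omega:\operatorname{Simp}^k(D)\to\mathbb{R}$, written $\omega_S=\langle S,\omega\rangle$ and extended linearly to chains. Pointwise convergence $\omega^j\to\omega$ means $\omega^j_S\to\omega_S$ for every $S\in\operatorname{Simp}^k(D)$. The boundary is $\partial[p_0\ldots p_k]=\sum_{i=0}^k(-1)^i[p_0\ldots\hat p_i\ldots p_k]$, and $\langle S,\delta\omega\rangle:=\langle\partial S,\omega\rangle$ for $S\in \operatorname{Simp}^{k+1}(D)$. For $S=[p_0\ldots p_k]$, $\operatorname{vol}_k(S)=\frac1{k!}\sqrt{\det(PP^T)}$, where $P$ is the matrix with rows $p_i-p_0$, $i=1,\dots,k$. A $k$-germ $\omega$ is nonatomic if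 $\omega_S=0$ whenever $\operatorname{vol}_k(S)=0$; it is closed on $k$-planes if for every affine $\varphi:I\subseteq\mathbb{R}^k\to D$ the germ $S\mapsto\omega_{\varphi_\natural S}$ on $\operatorname{Simp}^k(I)$ has $\delta$ equal to $0$, where $\varphi_\natural[p_0\ldots p_k]=[\varphi(p_0)\ldots\varphi(p_k)]$; it is regular if it is nonatomic and closed on $k$-planes. A $k$-gauge is a nonnegative $k$-germ $\mathsf{v}$; it is uniform if it takes equal values on $k$-simplices $S,S'$ in $D$ that are isometric, i.e. there is an isometry of $\mathbb{R}^d$ mapping the $j$-th vertex of $S$ to the $j$-th vertex of $S'$ for all $j$. $[\omega]_{\mathsf{v}}\in[0,\infty]$ is the infimum of constants $c\ge 0$ with $|\omega_S|\le c\,\mathsf{v}_S$ for all $S$; $\omega\approx_{\mathsf{v}}\tilde\omega$ means $[\omega-\tilde\omega]_{\mathsf{v}}<\infty$. $(\lambda)_\natural S$ is the image of $S$ under $x\mapsto\lambda x$; for a uniform gauge $\langle(2^{-n})_\natural S,\mathsf{v}\rangle$ is understood as the value on any translated copy of $(2^{-n})_\natural S$ contained in $D$. A gauge $\mathsf{v}$ is $r$-Dini ($r\ge0$) if it is uniform and $\lim_{n\to\infty}2^{nr}\langle(2^{-n})_\natural S,\mathsf{v}\rangle=0$ for every simplex $S$ (of the relevant dimension) in $D$. A $k$-germ $\omega$ is $\mathsf{v}$-sewable, for a $k$-Dini $k$-gauge $\mathsf{v}$, if there exists a regular $k$-germ $\operatorname{sew}\omega$ with $\omega\approx_{\mathsf{v}}\operatorname{sew}\omega$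 (for $k\in\{1,2\}$ such a germ is unique, also independently of the choice of $\mathsf{v}$); $\omega$ is sewable if it is $\mathsf{v}$-sewable for some $k$-Dini gauge $\mathsf{v}$. *)

(* Defs.v *)
From HB Require Import structures.
From mathcomp Require Import all_boot all_order all_algebra.
From mathcomp Require Import all_classical all_reals all_analysis.

Set Implicit Arguments.
Unset Strict Implicit.
Unset Printing Implicit Defensive.
Import Order.TTheory GRing.Theory Num.Theory numFieldNormedType.Exports.
Local Open Scope classical_set_scope.
Local Open Scope ring_scope.

Definition conv (R : realType) (d k : nat) (p : 'I_k.+1 -> 'rV[R]_d) :
    set 'rV[R]_d :=
  [set x | exists w : 'I_k.+1 -> R, [/\ forall i, 0 <= w i,
     \sum_(i < k.+1) w i = 1 & x = \sum_(i < k.+1) w i *: p i]].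

Lemma conv_vertex (R : realType) d k (p : 'I_k.+1 -> 'rV[R]_d) i :
  conv p (p i).
Proof.
exists (fun j => (j == i)%:R); split.
- by move=> j; rewrite ler0n.
- by rewrite -natr_sum -big_mkcond big_pred1_eq.
- rewrite (bigD1 i) //= eqxx scale1r big1 ?addr0 // => j /negbTE ->.
  by rewrite scale0r.
Qed.

Lemma sub_conv (R : realType) d k m (p : 'I_k.+1 -> 'rV[R]_d)
    (q : 'I_m.+1 -> 'rV[R]_d) :
  (forall i, conv p (q i)) -> conv q `<=` conv p.
Proof.
move=> hq x [w [w0 w1 ->]].
have [u hu] := choice hq.
exists (fun j => \sum_i w i * u i j); split.
- by move=> j; apply: sumr_ge0 => i _; have [u0 _ _] := hu i; rewrite mulr_ge0.
- rewrite exchange_big -[RHS]w1; apply: eq_bigr => i _ /=.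
  by have [_ u1 _] := hu i; rewrite -mulr_sumr u1 mulr1.
- under [RHS]eq_bigr do rewrite scaler_suml.
  rewrite exchange_big; apply: eq_bigr => i _ /=.
  have [_ _ {1}->] := hu i; rewrite scaler_sumr.
  by apply: eq_bigr => j _; rewrite scalerA.
Qed.

(* The vertices belong to [D] by [conv_vertex]. *)
Record simplex (R : realType) (d : nat) (D : set 'rV[R]_d) (k : nat) := Simplex {
  vertex :> 'I_k.+1 -> 'rV[R]_d;
  conv_simplex : conv vertex `<=` D }.

Definition germ (R : realType) (d : nat) (D : set 'rV[R]_d) (k : nat) :=
  simplex D k -> R.

Section Germs.
Variables (R : realType) (d : nat) (D : set 'rV[R]_d).

Lemma conv_face k (S : simplex D k.+1) (i : 'I_k.+2) :
  conv (fun j : 'I_k.+1 => S (lift i j)) `<=` D.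
Proof.
by apply: subset_trans (@conv_simplex _ _ _ _ S); apply: sub_conv => j;
  exact: conv_vertex.
Qed.

Definition face k (S : simplex D k.+1) (i : 'I_k.+2) : simplex D k :=
  Simplex (@conv_face k S i).

(* The linear extension of [w] evaluated on the chain
   \sum_i (-1)^i [p_0 .. p_(i-1) p_(i+1) .. p_(k+1)]. *)
Definition coboundary k (w : germ D k) : germ D k.+1 :=
  fun S => \sum_(i < k.+2) (-1) ^+ i * w (face S i).

Definition edge_mx k (S : simplex D k) : 'M[R]_(k, d) :=
  \matrix_(i < k) (S (lift ord0 i) - S ord0).

Definition vol k (S : simplex D k) : R :=
  (k`!%:R)^-1 * Num.sqrt (\det (edge_mx S *m (edge_mx S)^T)).

Definition nonatomic k (w : germ D k) : Prop :=
  forall S : simplex D k, vol S = 0 -> w S = 0.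

(* [phi] is affine as a map on [I]; its values outside [I] are irrelevant. *)
Definition affine_on m (I : set 'rV[R]_m) (phi : 'rV[R]_m -> 'rV[R]_d) : Prop :=
  exists (A : 'M[R]_(m, d)) (b : 'rV[R]_d), forall x, I x -> phi x = x *m A + b.

Lemma conv_push m (I : set 'rV[R]_m) (phi : 'rV[R]_m -> 'rV[R]_d)
    (aphi : affine_on I phi) (Iphi : {homo phi : x / I x >-> D x})
    k (S : simplex I k) : conv (phi \o S) `<=` D.
Proof.
move=> _ [w [w0 w1 ->]]; have [A [b phiE]] := aphi.
have Ix : I (\sum_i w i *: S i) by apply: (@conv_simplex _ _ _ _ S); exists w.
suff -> : \sum_i w i *: (phi \o S) i = phi (\sum_i w i *: S i) by exact: Iphi.
rewrite (phiE _ Ix) mulmx_suml -[in RHS](scale1r b) -w1 scaler_suml -big_split.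
apply: eq_bigr => i _ /=; rewrite phiE ?scalerDr ?scalemxAl //.
exact/(@conv_simplex _ _ _ _ S)/conv_vertex.
Qed.

Definition push m (I : set 'rV[R]_m) (phi : 'rV[R]_m -> 'rV[R]_d)
    (aphi : affine_on I phi) (Iphi : {homo phi : x / I x >-> D x})
    k (S : simplex I k) : simplex D k :=
  Simplex (conv_push aphi Iphi (S := S)).

End Germs.

Section Sewing.
Variables (R : realType) (d : nat) (D : set 'rV[R]_d) (k : nat).
Implicit Types (w eta v : germ D k) (S T : simplex D k).

Definition closed_on_planes w : Prop :=
  forall (I : set 'rV[R]_k) (phi : 'rV[R]_k -> 'rV[R]_d)
    (aphi : affine_on I phi) (Iphi : {homo phi : x / I x >-> D x})
    (S : simplex I k.+1),
  coboundary (fun S' : simplex I k => w (push aphi Iphi S')) S = 0.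

Definition regular w : Prop := nonatomic w /\ closed_on_planes w.

Definition gauge v : Prop := forall S, 0 <= v S.

(* The library norm on ['rV[R]_d] is the sup norm. *)
Definition enorm (x : 'rV[R]_d) : R := Num.sqrt (\sum_(i < d) x 0 i ^+ 2).

Definition isometry (f : 'rV[R]_d -> 'rV[R]_d) : Prop :=
  forall x y, enorm (f x - f y) = enorm (x - y).

Definition isometric S T : Prop :=
  exists2 f, isometry f & forall i, T i = f (S i).

Definition uniform v : Prop := forall S T, isometric S T -> v S = v T.

(* [T] is a translated copy, contained in [D], of the image of [S] under
   x |-> c x. *)
Definition scaled_copy (c : R) S T : Prop :=
  exists a : 'rV[R]_d, forall i, T i = c *: S i + a.

Lemma scaled_copy_exists (c : R) S : 0 <= c <= 1 -> exists T, scaled_copy c S T.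
Proof.
move=> /andP[c0 c1]; pose t i := c *: S i + (1 - c) *: S ord0.
suff tD : conv t `<=` D by exists (Simplex tD); exists ((1 - c) *: S ord0).
apply: subset_trans (@conv_simplex _ _ _ _ S); apply: sub_conv => i.
exists (fun j => c * (j == i)%:R + (1 - c) * (j == ord0)%:R); split.
- by move=> j; rewrite addr_ge0 ?mulr_ge0 ?subr_ge0 ?ler0n.
- rewrite big_split /= -!mulr_sumr -!natr_sum -!big_mkcond !big_pred1_eq !mulr1.
  by rewrite addrC subrK.
- under eq_bigr do rewrite scalerDl -!scalerA.
  rewrite big_split /= -!scaler_sumr; congr (_ *: _ + _ *: _).
  + rewrite (bigD1 i) //= eqxx scale1r big1 ?addr0 // => j /negbTE ->.
    by rewrite scale0r.
  + rewrite (bigD1 ord0) //= scale1r big1 ?addr0 // => j /negbTE ->.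
    by rewrite scale0r.
Qed.

(* <(2^-n)S, v> is the value of [v] at any scaled copy; copies exist by
   [scaled_copy_exists], and all have the same value as [v] is uniform. *)
Definition dini (r : R) v : Prop :=
  [/\ gauge v, uniform v &
    forall S (T : nat -> simplex D k),
      (forall n, scaled_copy (2 ^- n) S (T n)) ->
      (fun n => 2 `^ (n%:R * r) * v (T n)) @ \oo --> (0 : R)].

Definition gauge_seminorm v w : \bar R :=
  ereal_inf [set c%:E | c in
    [set c : R | 0 <= c /\ forall S, `|w S| <= c * v S]].

Definition germB w eta : germ D k := fun S => w S - eta S.

Definition approx v w eta : Prop :=
  (gauge_seminorm v (germB w eta) < +oo)%E.

Definition sewing v w eta : Prop := regular eta /\ approx v w eta.

Definition sewable_for v w : Prop :=
  dini k%:R v /\ exists eta, sewing v w eta.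

Definition sewable w : Prop := exists v, sewable_for v w.

(* For k = 1, 2 the sewing is unique, also across all k-Dini gauges; the default
   value 0 is taken only when [w] is not sewable. *)
Definition sew w : germ D k :=
  xget (fun=> 0 : R) [set eta | exists2 v, dini k%:R v & sewing v w eta].

Definition germ_cvg (w_ : nat -> germ D k) w : Prop :=
  forall S, (fun j => w_ j S) @ \oo --> w S.

End Sewing.

(* Main.v *)
Require Import Defs.
From HB Require Import structures.
From mathcomp Require Import all_boot all_order all_algebra.
From mathcomp Require Import all_classical all_reals all_analysis.
From mathcomp Require Import ring lra.
Import Order.TTheory GRing.Theory Num.Theory numFieldNormedType.Exports.
Local Open Scope classical_set_scope.
Local Open Scope ring_scope.

(** A regular germ is determined by its values on arbitrarily small simplices:
    for [k = 1, 2], bisecting the edges cuts a [k]-simplex [S] into [2 ^ k]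
    simplices that are copies of [S] scaled by [1/2] or [-1/2], vertex order
    included, and every regular germ is additive along this subdivision
    ([halving]); for [k = 2] this follows from the vanishing of the coboundary
    on flat tetrahedra spanned by vertices and midpoints ([subdivision2]).  A
    uniform gauge takes the same value on all these pieces, since translations
    and point reflections are isometries.  Hence a regular germ bounded by a gauge [v]
    satisfies, after [n] subdivisions, |e_S| <= 2^(nk) v_(2^-n S), and the
    right-hand side tends to 0 when [v] is [k]-Dini.

    The same argument works for a family of regular germs [e_t] for which
    |e_t| <= v + eps holds on each simplex eventually in [t]: as only finitely
    many simplices occur at each level, letting [t] go to its limit for a fixed
    level gives e_t -> 0 pointwise ([dini_vanish]).  Two instances prove the
    theorem.  Applied to the differences of sew w_i and sew w_j, which are
    bounded by 2 c v + |w_i - w_j|, it shows that (sew w_j) is pointwise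
    Cauchy; the limit [eta] is regular ([regular_lim]) and |w - eta| <= c v,
    so [eta] is a sewing of [w].  Applied to a constant family, it shows that
    sewings are unique ([sewing_unique]), so that [eta] is sew w. *)

Local Notation conv := Defs.conv.

(** * Germs on lists of points *)

Section Simplices.
Set Implicit Arguments.
Unset Strict Implicit.
Variables (R : realType) (d : nat) (D : set 'rV[R]_d).

(** Extending a germ by 0 to all tuples of points allows cocycle identities
    to be written without carrying the proofs that the hulls lie in [D]. *)
Definition ext k (f : germ D k) (p : 'I_k.+1 -> 'rV[R]_d) : R :=
  match pselect (conv p `<=` D) with
  | left pD => f (Simplex pD)
  | right _ => 0
  end.

Lemma extE k (f : germ D k) (S : simplex D k) : ext f S = f S.
Proof.
case: S => p pD; rewrite /ext /=; case: pselect => // pD'.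
by congr (f (Simplex _)); exact: Prop_irrelevance.
Qed.

Lemma conv_midpoint k (p : 'I_k.+1 -> 'rV[R]_d) x y :
  conv p x -> conv p y -> conv p (2^-1 *: x + 2^-1 *: y).
Proof.
move=> [u [u0 u1 ->]] [w [w0 w1 ->]].
exists (fun i => 2^-1 * u i + 2^-1 * w i); split.
- by move=> i; rewrite addr_ge0 ?mulr_ge0 ?invr_ge0.
- by rewrite big_split /= -!mulr_sumr u1 w1; field.
- rewrite !scaler_sumr -big_split; apply: eq_bigr => i _ /=.
  by rewrite scalerDl !scalerA.
Qed.

(** Closedness on planes in usable form.  The plane is the affine hull of a
    simplex [S] in [D], parametrized by barycentric coordinates with respect to
    [S]; convexity of the hull of [S] keeps everything in [D]. *)
Lemma closed_cocycle k (f : germ D k) (S : simplex D k)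
    (q : 'I_k.+2 -> 'rV[R]_d) :
  closed_on_planes f -> (forall i, conv S (q i)) ->
  \sum_(i < k.+2) (-1) ^+ i * ext f (q \o lift i) = 0.
Proof.
move=> fC qS.
pose phi (x : 'rV[R]_k) := x *m edge_mx S + S ord0.
pose I := phi @^-1` D.
have aphi : affine_on I phi by exists (edge_mx S), (S ord0).
have Iphi : {homo phi : x / I x >-> D x} by [].
have [w wP] := choice qS.
pose y i : 'rV[R]_k := \row_j w i (lift ord0 j).
have phiy i : phi (y i) = q i.
  have [_ w1 ->] := wP i; rewrite /phi mulmx_sum_row [RHS]big_ord_recl.
  rewrite -[S ord0 in LHS]scale1r -w1 big_ord_recl /= scalerDl scaler_suml.
  rewrite addrCA -big_split /=; congr (_ + _); apply: eq_bigr => j _.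
  by rewrite rowK mxE scalerBr subrK.
have phi_conv u : \sum_i u i = 1 ->
    phi (\sum_(i < k.+2) u i *: y i) = \sum_i u i *: q i.
  move=> u1.
  rewrite /phi mulmx_suml -[S ord0]scale1r -u1 scaler_suml -big_split.
  by apply: eq_bigr => i _ /=; rewrite -phiy scalerDr scalemxAl.
have yI : conv y `<=` I.
  move=> _ [u [u0 u1 ->]]; rewrite /I /= phi_conv //.
  by apply: conv_simplex; apply: (sub_conv qS); exists u.
rewrite -[RHS](fC I phi aphi Iphi (Simplex yI)); apply: eq_bigr => i _.
congr (_ * _); rewrite -[RHS]extE; congr (ext f _).
by apply: funext => j /=; rewrite phiy.
Qed.

(** A linear relation between the edge vectors annihilates the Gram matrix, so
    the simplex has volume 0. *)
Lemma nonatomic_ext k (f : germ D k) (p : 'I_k.+1 -> 'rV[R]_d) (u : 'I_k -> R)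
    (i0 : 'I_k) : nonatomic f -> u i0 != 0 ->
  \sum_i u i *: (p (lift ord0 i) - p ord0) = 0 -> ext f p = 0.
Proof.
move=> f0 ui0 up; rewrite /ext; case: pselect => // pD; apply: f0.
pose a : 'rV[R]_k := \row_i u i.
suff /eqP detP : \det (edge_mx (Simplex pD) *m (edge_mx (Simplex pD))^T) == 0.
  by rewrite /vol detP sqrtr0 mulr0.
apply/det0P; exists a.
  by apply: contraNneq ui0 => /rowP /(_ i0); rewrite !mxE => ->.
suff aE : a *m edge_mx (Simplex pD) = 0 by rewrite mulmxA aE mul0mx.
rewrite mulmx_sum_row -[RHS]up; apply: eq_bigr => i _.
by rewrite rowK mxE.
Qed.

Lemma scaled_copy_trans k c c' (S T U : simplex D k) :
  scaled_copy c S T -> scaled_copy c' T U -> scaled_copy (c' * c) S U.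
Proof.
move=> [a Ta] [b Ub]; exists (c' *: a + b) => i.
by rewrite Ub Ta scalerDr scalerA addrA.
Qed.

(** The sign of the factor is immaterial, because x |-> - x is an isometry;
    this is what lets a uniform gauge ignore the point-reflected central piece
    of a subdivided triangle. *)
Lemma scaled_copy_isometric k c c' (S T T' : simplex D k) :
  `|c| = `|c'| -> scaled_copy c S T -> scaled_copy c' S T' -> isometric T T'.
Proof.
move=> cc' [a Ta] [b Tb].
have [s s2 c'E] : exists2 s : R, s ^+ 2 = 1 & c' = s * c.
  have /eqP := cc'; rewrite eqr_norm2 => /orP[] /eqP ->.
    by exists 1; rewrite ?expr1n ?mul1r.
  by exists (-1); rewrite ?sqrrN ?expr1n ?mulN1r ?opprK.
exists (fun x => s *: x + (b - s *: a)); last first.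
  move=> i.
  by rewrite Tb Ta c'E scalerDr scalerA -addrA [s *: a + _]addrC subrK.
move=> x y; rewrite opprD addrACA subrr addr0 -scalerBr /enorm.
congr (Num.sqrt _); apply: eq_bigr => i _.
by rewrite !mxE exprMn s2 mul1r.
Qed.

End Simplices.

(** * Dyadic subdivision of segments and triangles *)

Section Subdivision.
Set Implicit Arguments.
Unset Strict Implicit.
Variables (R : realType) (d : nat) (D : set 'rV[R]_d).

Definition vertices k (s : seq 'rV[R]_d) : 'I_k.+1 -> 'rV[R]_d :=
  fun i => nth 0 s i.

Definition mid (x y : 'rV[R]_d) : 'rV[R]_d := 2^-1 *: x + 2^-1 *: y.

Lemma midC x y : mid x y = mid y x.
Proof. exact: addrC. Qed.

Lemma midxx x : mid x x = x.
Proof. by rewrite /mid -scalerDl (_ : 2^-1 + 2^-1 = 1) ?scale1r //; field. Qed.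

Lemma cocycle1 (f : germ D 1) (S : simplex D 1) a b c :
  closed_on_planes f -> conv S a -> conv S b -> conv S c ->
  ext f (vertices [:: b; c]) - ext f (vertices [:: a; c])
    + ext f (vertices [:: a; b]) = 0.
Proof.
move=> fC Sa Sb Sc; pose q := @vertices 2 [:: a; b; c].
have qS i : conv S (q i) by case: i => [[|[|[|]]]].
rewrite -[RHS](closed_cocycle fC qS) !big_ord_recl big_ord0 /=.
rewrite !exprS expr0 !mulr1 mulrNN !mul1r mulN1r addr0 addrA.
by congr (ext f _ - ext f _ + ext f _); apply: funext => -[[|[|]]].
Qed.

Lemma cocycle2 (f : germ D 2) (S : simplex D 2) a b c e :
  closed_on_planes f -> conv S a -> conv S b -> conv S c -> conv S e ->
  ext f (vertices [:: b; c; e]) - ext f (vertices [:: a; c; e])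
    + ext f (vertices [:: a; b; e]) - ext f (vertices [:: a; b; c]) = 0.
Proof.
move=> fC Sa Sb Sc Se; pose q := @vertices 3 [:: a; b; c; e].
have qS i : conv S (q i) by case: i => [[|[|[|[|]]]]].
rewrite -[RHS](closed_cocycle fC qS) !big_ord_recl big_ord0 /=.
rewrite !exprS expr0 !mulr1 mulrNN !mulr1 !mul1r !mulN1r addr0 !addrA.
by congr (ext f _ - ext f _ + ext f _ - ext f _);
  apply: funext => -[[|[|[|]]]].
Qed.

Lemma nonatomic_collinear (f : germ D 2) a b c s t : nonatomic f ->
  (s != 0) || (t != 0) -> s *: (b - a) + t *: (c - a) = 0 ->
  ext f (vertices [:: a; b; c]) = 0.
Proof.
move=> f0 st0 abc; pose u (i : 'I_2) := nth 0 [:: s; t] i.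
have [i0 ui0] : exists i0, u i0 != 0.
  by case/orP: st0 => ?; [exists ord0|exists (lift ord0 ord0)].
apply: (@nonatomic_ext _ _ _ _ _ _ u i0 f0 ui0).
by rewrite big_ord_recl big_ord1.
Qed.

Lemma subdivision1 (f : germ D 1) (S : simplex D 1) a b :
  closed_on_planes f -> conv S a -> conv S b ->
  ext f (vertices [:: a; b]) =
  ext f (vertices [:: a; mid a b]) + ext f (vertices [:: mid a b; b]).
Proof.
move=> fC Sa Sb.
have Sm := conv_midpoint Sa Sb.
by have := cocycle1 fC Sa Sm Sb; rewrite -/(mid _ _); lra.
Qed.

(** Regular 2-germs are alternating: this is the cocycle identity on the
    flat tetrahedra a b a c and a b c b, whose other faces are degenerate. *)
Lemma swap01 (f : germ D 2) (S : simplex D 2) a b c :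
  regular f -> conv S a -> conv S b -> conv S c ->
  ext f (vertices [:: b; a; c]) = - ext f (vertices [:: a; b; c]).
Proof.
move=> [f0 fC] Sa Sb Sc; have := cocycle2 fC Sa Sb Sa Sc.
rewrite (@nonatomic_collinear _ a a c 1 0 f0) ?oner_neq0 //; last first.
  by rewrite subrr scaler0 scale0r addr0.
rewrite (@nonatomic_collinear _ a b a 0 1 f0) ?oner_neq0 ?orbT //; last first.
  by rewrite subrr scaler0 scale0r addr0.
by lra.
Qed.

Lemma swap12 (f : germ D 2) (S : simplex D 2) a b c :
  regular f -> conv S a -> conv S b -> conv S c ->
  ext f (vertices [:: a; c; b]) = - ext f (vertices [:: a; b; c]).
Proof.
move=> [f0 fC] Sa Sb Sc; have := cocycle2 fC Sa Sb Sc Sb.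
rewrite (@nonatomic_collinear _ b c b 0 1 f0) ?oner_neq0 ?orbT //; last first.
  by rewrite subrr scaler0 scale0r addr0.
rewrite (@nonatomic_collinear _ a b b 1 (-1) f0) ?oner_neq0 //; last first.
  by rewrite scale1r scaleN1r subrr.
by lra.
Qed.

(** The cocycle identity on a b c m, with [m] the midpoint of the edge a b,
    where the face a b m is degenerate. *)
Lemma split_edge (f : germ D 2) (S : simplex D 2) a b c :
  regular f -> conv S a -> conv S b -> conv S c ->
  ext f (vertices [:: a; b; c]) =
  ext f (vertices [:: b; c; mid a b]) - ext f (vertices [:: a; c; mid a b]).
Proof.
move=> [f0 fC] Sa Sb Sc; have := cocycle2 fC Sa Sb Sc (conv_midpoint Sa Sb).
rewrite -/(mid a b) (@nonatomic_collinear _ a b (mid a b) 1 (-2) f0) ?oner_neq0 //.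
  by lra.
by rewrite /mid; apply/rowP => i; rewrite !mxE; field.
Qed.

(** Splitting at the midpoint of b c, and then splitting a b and a c in the two
    halves, yields the two corner triangles at [b] and [c] and two triangles
    that form the parallelogram on [a] and the three midpoints.  The cocycle
    identity on that parallelogram exchanges its diagonals.  The vertices of
    each piece are listed in the order in which it is a scaled copy of
    a b c. *)
Lemma subdivision2 (f : germ D 2) (S : simplex D 2) a b c :
  regular f -> conv S a -> conv S b -> conv S c ->
  ext f (vertices [:: a; b; c]) =
  ext f (vertices [:: a; mid a b; mid a c])
    + ext f (vertices [:: mid a b; b; mid b c])
    + ext f (vertices [:: mid a c; mid b c; c])
    + ext f (vertices [:: mid b c; mid a c; mid a b]).
Proof.
move=> fR Sa Sb Sc; have [_ fC] := fR.
have Sab := conv_midpoint Sa Sb.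
have Sac := conv_midpoint Sa Sc.
have Sbc := conv_midpoint Sb Sc.
rewrite -/(mid _ _) in Sab Sac Sbc.
(* cyclic invariance, from two transpositions *)
have cyc x y z : conv S x -> conv S y -> conv S z ->
    ext f (vertices [:: x; y; z]) = ext f (vertices [:: y; z; x]).
  move=> Sx Sy Sz.
  by rewrite (swap01 fR Sy Sx Sz) (swap12 fR Sy Sz Sx) ?opprK.
have := split_edge fR Sb Sc Sa; rewrite -(cyc a b c) //.
have := split_edge fR Sc Sa Sbc; rewrite (midC c a).
have := split_edge fR Sb Sa Sbc; rewrite (midC b a).
have := cocycle2 fC Sa Sbc Sac Sab.
have := swap12 fR Sa Sab Sac.
have := cyc _ _ _ Sab Sb Sbc.
have := cyc _ _ _ Sac Sbc Sc.
have := swap01 fR Sbc Sc Sac.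
lra.
Qed.

(** The pieces are chosen before the germ: one subdivision has to serve a whole
    family of germs at once in [dini_vanish]. *)
Lemma halving_of k n (S : simplex D k) (q : 'I_n -> 'I_k.+1 -> 'rV[R]_d) :
  (forall i j, conv S (q i j)) ->
  (forall i, exists c a, `|c| = 2^-1 /\ forall j, q i j = c *: S j + a) ->
  (forall f : germ D k, regular f -> ext f S = \sum_i ext f (q i)) ->
  exists P : 'I_n -> simplex D k,
    (forall i, exists2 c, `|c| = 2^-1 & scaled_copy c S (P i)) /\
    (forall f : germ D k, regular f -> f S = \sum_i f (P i)).
Proof.
move=> qS qc qf.
have qD i : conv (q i) `<=` D.
  by apply: subset_trans (sub_conv (qS i)) (@conv_simplex _ _ _ _ S).
exists (fun i => Simplex (qD i)); split.
  by move=> i; have [c [a [c2 ca]]] := qc i; exists c => //; exists a.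
move=> f fR; rewrite -[LHS]extE qf //; apply: eq_bigr => i _.
by rewrite -[RHS]extE.
Qed.

Lemma halving1 (S : simplex D 1) : exists P : 'I_2 -> simplex D 1,
  (forall i, exists2 c, `|c| = 2^-1 & scaled_copy c S (P i)) /\
  (forall f : germ D 1, regular f -> f S = \sum_i f (P i)).
Proof.
set a := S ord0; set b := S ord_max.
have SE : S = vertices [:: a; b] :> ('I_2 -> _).
  by apply: funext => -[[|[|]]] // h; congr (S _); apply: val_inj.
have [Sa Sb] : conv S a /\ conv S b by split; exact: conv_vertex.
have Sm := conv_midpoint Sa Sb.
pose q (i : 'I_2) :=
  nth (vertex S) [:: vertices [:: a; mid a b]; vertices [:: mid a b; b]] i.
apply: (@halving_of _ _ _ q).
- by move=> [[|[|]]] // ? [[|[|]]].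
- move=> i; exists 2^-1, (2^-1 *: (if i == ord0 then a else b)).
  split; first by rewrite ger0_norm ?invr_ge0.
  move=> j; rewrite -/(mid _ _) SE.
  by case: i j => [[|[|]]] // ? [[|[|]]] // ?;
    rewrite /q /vertices /= ?midxx // midC.
- move=> f [_ fC]; rewrite big_ord_recl big_ord1 SE.
  exact: (subdivision1 fC Sa Sb).
Qed.

Lemma halving2 (S : simplex D 2) : exists P : 'I_4 -> simplex D 2,
  (forall i, exists2 c, `|c| = 2^-1 & scaled_copy c S (P i)) /\
  (forall f : germ D 2, regular f -> f S = \sum_i f (P i)).
Proof.
set a := S ord0; set b := S (lift ord0 ord0); set c := S ord_max.
have SE : S = vertices [:: a; b; c] :> ('I_3 -> _).
  by apply: funext => -[[|[|[|]]]] // h; congr (S _); apply: val_inj.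
have [Sa Sb Sc] : [/\ conv S a, conv S b & conv S c].
  by split; exact: conv_vertex.
have Sab := conv_midpoint Sa Sb.
have Sac := conv_midpoint Sa Sc.
have Sbc := conv_midpoint Sb Sc.
pose q (i : 'I_4) := nth (vertex S) [:: vertices [:: a; mid a b; mid a c];
  vertices [:: mid a b; b; mid b c]; vertices [:: mid a c; mid b c; c];
  vertices [:: mid b c; mid a c; mid a b]] i.
have n2 : `|2^-1| = 2^-1 :> R by rewrite ger0_norm ?invr_ge0.
apply: (@halving_of _ _ _ q).
- by move=> [[|[|[|[|]]]]] // ? [[|[|[|]]]].
- move=> i; have [i3|i3] := eqVneq i ord_max.
    (* central piece: the reflection sends each vertex to the midpoint of the
       opposite edge *)
    exists (- 2^-1), (2^-1 *: (a + b + c)); rewrite normrN; split=> // j.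
    rewrite i3 SE /q /=.
    by case: j => [[|[|[|]]]] // ?; rewrite /vertices /mid /=;
      apply/rowP => l; rewrite !mxE; ring.
  exists 2^-1, (2^-1 *: nth 0 [:: a; b; c] i); split=> // j.
  rewrite -/(mid _ _) SE.
  case: i i3 => [[|[|[|[|]]]]] // ? _;
    by case: j => [[|[|[|]]]] // ?; rewrite /q /vertices /= ?midxx // midC.
- move=> f fR; rewrite !big_ord_recl big_ord0 addr0 SE !addrA.
  exact: (subdivision2 fR Sa Sb Sc).
Qed.

Lemma halving k (S : simplex D k) : k = 1%N \/ k = 2%N ->
  exists P : 'I_(2 ^ k) -> simplex D k,
    (forall i, exists2 c, `|c| = 2^-1 & scaled_copy c S (P i)) /\
    (forall f : germ D k, regular f -> f S = \sum_i f (P i)).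
Proof.
by move=> k12; case: k12 S => -> S; [exact: halving1|exact: halving2].
Qed.

End Subdivision.

(** * Convergence of germs and Dini gauges *)

Section Convergence.
Set Implicit Arguments.
Unset Strict Implicit.
Variables (R : realType) (d : nat) (D : set 'rV[R]_d) (k : nat).
Implicit Types (v w eta : germ D k) (S T : simplex D k).

Lemma dyadic_copy n S : exists T, scaled_copy (2 ^- n) S T.
Proof.
apply: scaled_copy_exists.
by rewrite invr_ge0 exprn_ge0 //= invf_le1 ?exprn_gt0 ?exprn_ege1 ?ler1n.
Qed.

Lemma dini_cvg v S (T : nat -> simplex D k) : dini k%:R v ->
  (forall n, scaled_copy (2 ^- n) S (T n)) ->
  (2 ^ k)%:R ^+ n * v (T n) @[n --> \oo] --> (0 : R).
Proof.
move=> [_ _ v0] ST.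
under eq_fun do rewrite natrX -exprM mulnC -powR_mulrn // natrM.
exact: v0 ST.
Qed.

Lemma diniD (c c' : R) v v' :
  0 <= c -> 0 <= c' -> dini k%:R v -> dini k%:R v' ->
  dini k%:R (fun S => c * v S + c' * v' S).
Proof.
move=> c0 c'0 [v0 vu vd] [v'0 v'u v'd]; split.
- by move=> S; rewrite addr_ge0 ?mulr_ge0.
- by move=> S T ST; rewrite (vu _ _ ST) (v'u _ _ ST).
move=> S T ST.
under eq_fun do rewrite mulrDr !(mulrCA (2 `^ _)).
have := cvgD (cvgM (cvg_cst c) (vd S T ST)) (cvgM (cvg_cst c') (v'd S T ST)).
by rewrite !mulr0 addr0; apply.
Qed.

Lemma regularB w eta : regular w -> regular eta -> regular (germB w eta).
Proof.
move=> [w0 wC] [e0 eC]; split.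
  by move=> S S0; rewrite /germB w0 // e0 // subrr.
move=> I phi aphi Iphi S; rewrite -[RHS](subrr 0).
rewrite -[X in X - _](wC I phi aphi Iphi S) -[X in _ - X](eC I phi aphi Iphi S).
by rewrite /coboundary -sumrB; apply: eq_bigr => i _; rewrite -mulrBr.
Qed.

(** Both conditions are given by equations, each of which involves finitely
    many values of the germ. *)
Lemma regular_lim (w_ : nat -> germ D k) w :
  (forall j, regular (w_ j)) -> germ_cvg w_ w -> regular w.
Proof.
move=> w_R w_w; split.
  move=> S S0; apply: (cvg_unique (@Rhausdorff R) (w_w S)).
  rewrite (_ : (fun j => w_ j S) = fun=> 0); first exact: cvg_cst.
  by apply: funext => j; have [-> ] := w_R j.
move=> I phi aphi Iphi S.
pose pull f := fun S' : simplex I k => f (push aphi Iphi S') : R.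
have cob : coboundary (pull (w_ j)) S @[j --> \oo] --> coboundary (pull w) S.
  rewrite /coboundary; apply: cvg_big; first exact: add_continuous.
  by move=> i _; apply: cvgM; [exact: cvg_cst|exact: w_w].
apply: (cvg_unique (@Rhausdorff R) cob).
rewrite (_ : (fun j => _) = fun=> 0); first exact: cvg_cst.
by apply: funext => j; have [_ ->] := w_R j.
Qed.

(** Induction on the level [n] of the subdivision: the bound at a simplex is
    the sum of the bounds at its [2 ^ k] halves, on which the gauge takes equal
    values.  The error [eps] is shared between the halves, so it stays
    arbitrary, and a fixed [n] only involves finitely many conditions on [t].
    The Dini condition is used once, at the end, to choose [n]. *)
Lemma dini_vanish (X : Type) (F : set_system X) (FF : Filter F)
    (e : X -> germ D k) v :
  k = 1%N \/ k = 2%N -> dini k%:R v -> (forall t, regular (e t)) ->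
  (forall S eps, 0 < eps -> \forall t \near F, `|e t S| <= v S + eps) ->
  forall S, e t S @[t --> F] --> (0 : R).
Proof.
move=> k12 vD eR ev S; have [v0 vu _] := vD.
have N0 : 0 < (2 ^ k)%:R :> R by rewrite ltr0n expn_gt0.
have bound n : forall U T, scaled_copy (2 ^- n) U T -> forall eps, 0 < eps ->
    \forall t \near F, `|e t U| <= (2 ^ k)%:R ^+ n * v T + eps.
  elim: n => [|n IHn] U T UT eps eps0.
    rewrite expr0 mul1r -(vu U T); first exact: ev.
    apply: (@scaled_copy_isometric _ _ _ _ 1 (2 ^- 0) U) UT => //.
    - by rewrite expr0 invr1.
    - by exists 0 => i; rewrite scale1r addr0.
  have [P [Pc Pf]] := halving U k12.
  have pieces : \forall t \near F, forall i,
      `|e t (P i)| <= (2 ^ k)%:R ^+ n * v T + eps / (2 ^ k)%:R.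
    apply: filter_forall => i; have [c c2 UP] := Pc i.
    have [Q PQ] := dyadic_copy n (P i).
    have -> : v T = v Q.
      apply: vu; apply: scaled_copy_isometric UT (scaled_copy_trans UP PQ).
      rewrite normrM c2 !ger0_norm ?invr_ge0 ?exprn_ge0 //.
      by rewrite exprSr invfM mulrC.
    by apply: IHn => //; rewrite divr_gt0.
  apply: filterS pieces => t Pt; rewrite (Pf (e t)) //.
  apply: le_trans (ler_norm_sum _ _ _) _.
  apply: le_trans (ler_sum _ (fun i _ => Pt i)) _.
  rewrite sumr_const card_ord -[leLHS]mulr_natl mulrDr mulrA -exprS mulrCA.
  by rewrite divff ?mulr1 // gt_eqF.
apply/cvgr0Pnorm_le => eps eps0.
have [T ST] := choice (fun n => dyadic_copy n S).
have e20 : 0 < eps / 2 by rewrite divr_gt0.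
have /cvgr0Pnorm_le/(_ _ e20)[n _ /(_ n (leqnn n)) vn] := dini_cvg vD ST.
have := bound n S (T n) (ST n) _ e20; apply: filterS => t /le_trans; apply.
by rewrite [leRHS](splitr eps) lerD2r (le_trans (ler_norm _)).
Qed.

Lemma gauge_seminorm_lt v w (c : R) : gauge v ->
  (gauge_seminorm v w < c%:E)%E -> 0 <= c /\ forall S, `|w S| <= c * v S.
Proof.
move=> v0 /ereal_inf_lt[_ [c' [c'0 c'w] <-]]; rewrite lte_fin => /ltW c'c.
split; first exact: le_trans c'c.
by move=> S; rewrite (le_trans (c'w S)) // ler_wpM2r.
Qed.

Lemma approxP v w eta : gauge v -> Defs.approx v w eta <->
  exists2 c : R, 0 <= c & forall S, `|w S - eta S| <= c * v S.
Proof.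
move=> v0; split.
  move=> /ereal_inf_lt[_ [c [c0 cw] <-]] _; by exists c.
move=> [c c0 cw]; apply: (@le_lt_trans _ _ c%:E); last exact: ltry.
by apply: ereal_inf_lbound; exists c.
Qed.

(** The difference of two sewings is a regular germ bounded by a combination of
    the two gauges, which is again Dini; so the constant family it forms tends
    to 0. *)
Lemma sewing_unique v v' w eta eta' : k = 1%N \/ k = 2%N ->
  dini k%:R v -> dini k%:R v' -> sewing v w eta -> sewing v' w eta' ->
  forall S, eta S = eta' S.
Proof.
move=> k12 vD v'D [eR ev] [e'R e'v] S; apply/eqP; rewrite -subr_eq0; apply/eqP.
have [[v0 _ _] [v'0 _ _]] := (vD, v'D).
have /(approxP _ _ v0)[c c0 cw] := ev.
have /(approxP _ _ v'0)[c' c'0 c'w] := e'v.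
have wD := diniD c0 c'0 vD v'D.
have := dini_vanish (F := \oo) _ (e := fun=> germB eta eta') k12 wD.
move=> /(_ _ (fun=> regularB eR e'R)) cvg0.
apply: (cvg_unique (@Rhausdorff R)) (cvg0 _ S); first exact: cvg_cst.
move=> T eps eps0; near=> n; rewrite /germB.
rewrite (_ : eta T - eta' T = (w T - eta' T) - (w T - eta T)); last by ring.
rewrite (le_trans (ler_normB _ _)) // addrC; have := cw T; have := c'w T; lra.
Unshelve. all: by end_near. Qed.

Lemma sewP w : sewable w -> exists2 v, dini k%:R v & sewing v w (sew w).
Proof.
move=> [v [vD [eta we]]].
pose P := [set eta : germ D k | exists2 v, dini k%:R v & sewing v w eta].
have : P (xget (fun=> 0 : R) P) by apply: xgetPex; exists eta, v.
by [].
Qed.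

End Convergence.

Theorem theorem3p23 (R : realType) (d k : nat) (D : set 'rV[R]_d)
    (hk : k = 1%N \/ k = 2%N)
    (v : germ D k) (hv : dini k%:R v)
    (w_ : nat -> germ D k) (hw : forall j, sewable (w_ j))
    (w : germ D k) (w_cvg : germ_cvg w_ w)
    (w_bound : (ereal_sup [set gauge_seminorm v (germB (w_ j) (sew (w_ j))) | j in [set: nat]] < +oo)%E) :
  sewable_for v w /\ germ_cvg (fun j => sew (w_ j)) (sew w).
Proof.
have [v0 _ _] := hv.
have [c c0 cw] : exists2 c : R, 0 <= c &
    forall j S, `|w_ j S - sew (w_ j) S| <= c * v S.
  have [c c_sup] : exists c : R, (ereal_sup [set gauge_seminorm v
      (germB (w_ j) (sew (w_ j))) | j in [set: nat]] < c%:E)%E.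
    case: (ereal_sup _) w_bound => [r|//|] _.
      by exists (r + 1); rewrite lte_fin ltrDl.
    by exists 0; exact: ltNy0.
  have cj j : 0 <= c /\ forall S, `|germB (w_ j) (sew (w_ j)) S| <= c * v S.
    apply: gauge_seminorm_lt => //; apply: le_lt_trans c_sup.
    by apply: ereal_sup_ubound; exists j.
  by exists c; [have [] := cj 0%N|move=> j; have [] := cj j].
have sewR j : regular (sew (w_ j)) by have [? _ []] := sewP (hw j).
have sew_cvg S : cvg ((fun j => sew (w_ j) S) @ \oo).
  pose e (ij : nat * nat) := germB (sew (w_ ij.1)) (sew (w_ ij.2)).
  (* the Cauchy property is convergence along the product filter *)
  have e0 : forall S, e ij S @[ij --> (\oo, \oo)] --> (0 : R).
    apply: (dini_vanish _ hk (diniD c0 c0 hv hv)) => [ij|T eps eps0].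
      exact: regularB.
    have wT : \forall j \near \oo, `|w T - w_ j T| <= eps / 2.
      by move: (w_cvg T) => /cvgrPdist_le; apply; rewrite divr_gt0.
    apply/filter2P; exists ([set j | `|w T - w_ j T| <= eps / 2],
                      [set j | `|w T - w_ j T| <= eps / 2]) => // i j /= wi wj.
    have := cw i T; have := cw j T; move: wi wj.
    by rewrite /e /germB /= !ler_norml; lra.
  apply: cauchy_cvg; apply/cauchy_ballP => eps eps0.
  have /cvgr0Pnorm_lt/(_ _ eps0)/filter2P[[A B] /= [FA FB] AB] := e0 S.
  pose f j := sew (w_ j) S; apply/filter2P; exists (f @` A, f @` B).
    by split; [apply: filterS FA|apply: filterS FB] => j; exists j.
  by move=> _ _ [i Ai <-] [j Bj <-]; exact: AB.
have [eta eta_cvg] : exists eta : germ D k, germ_cvg (fun j => sew (w_ j)) eta.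
  by exists (fun S => lim ((fun j => sew (w_ j) S) @ \oo)) => S; exact: sew_cvg.
have eta_sew : sewing v w eta.
  split; first exact: regular_lim eta_cvg.
  apply/(approxP _ _ v0); exists c => // S.
  have w_eta : (fun j => `|w_ j S - sew (w_ j) S|) @ \oo --> `|w S - eta S|.
    by apply: cvg_norm; apply: cvgB; [exact: w_cvg|exact: eta_cvg].
  rewrite -(cvg_lim (@Rhausdorff R) w_eta); apply: limr_le.
    exact: cvgP w_eta.
  by apply: nearW => j; exact: cw.
have w_sew : sewable w by exists v; split=> //; exists eta.
split; first by split=> //; exists eta.
have [v' v'D sew_w] := sewP w_sew.
by move=> S; rewrite -(sewing_unique hk hv v'D eta_sew sew_w S).
Qed.
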